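(* Let $(R,\mathcal B)$ be a fusion ring having the Isaacs property, with standard basis $\mathcal B=\{x_0=1,x_1,\dots,x_m\}$. If the basis element $x_i\in\mathcal B$ is central in $R$ (i.e. $x_i\in Z(R)$), then $$\frac{\mathrm{FPdim}(R)}{\mathrm{FPdim}(x_i)}\in\mathbb A,$$ where $\mathbb A$ denotes the ring of algebraic integers.
   Context: A fusion ring $(R,\mathcal B)$ is a ring $R$, free as a $\mathbb Z$-module with finite basis $\mathcal B=\{x_0,\dots,x_m\}$ (the standard basis), such that $x_0=1$; $x_ix_j=\sum_k N_{ij}^k x_k$ with $N_{ij}^k\in\mathbb Z_{\ge 0}$; and there is an involutive ring anti-automorphism $^*$ of $R$ preserving $\mathcal B$, with $x_i^*=x_{i^*}$ and $N_{ij}^0=\delta_{i,j^*}$. $R$ need not be commutative. $d_i:=\mathrm{FPdim}(x_i)$ is the Frobenius-Perron dimension and $\mathrm{FPdim}(R)=\sum_i d_i^2$. $R_{\mathbb C}:=R\otimes_{\mathbb Z}\mathbb C$ is a semisimple algebra. $\mathrm{Irr}(R_{\mathbb C})$ is its set of irreducible representations, identified with their (trace) characters. For $\rho\in\mathrm{Irr}(R_{\mathbb C})$, $F^\rho\in R_{\mathbb C}$ is the corresponding primitive central idempotent. $\widehat{R_{\mathbb C}}:=(R_{\mathbb C})^*$ is the linear dual, and $\{x_i^\circ\}$ is the basis dual to $\{x_i\}$. The Fourier transform is the linear bijection $\mathcal F:R_{\mathbb C}\to\widehat{R_{\mathbb C}}$, $x_i\mapsto \mathrm{FPdim}(R)\,x_{i^*}^\circ$.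 The matrix class sums are $\mathrm S^\rho:=\mathcal F(F^\rho)$. Define $\widetilde\omega_i:\widehat{R_{\mathbb C}}\to\mathbb C$ by $\widetilde\omega_i(\mu)=\mu(x_i)/d_i$. $(R,\mathcal B)$ is Isaacs (has the Isaacs property) if $\widetilde\omega_i(\mathrm S^\rho)\in\mathbb A$ for all $x_i\in\mathcal B$ and all $\rho\in\mathrm{Irr}(R_{\mathbb C})$. *)

(* Defs.v *)
From HB Require Import structures.
From mathcomp Require Import all_boot all_order all_algebra all_field.
From mathcomp Require Import complex.
From mathcomp Require Import boolp classical_sets reals.

Set Implicit Arguments.
Unset Strict Implicit.
Unset Printing Implicit Defensive.

Import Order.TTheory GRing.Theory Num.Theory.
Local Open Scope ring_scope.

Record fusionRing := FusionRing {
  fr_rk : nat;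
  fr_carrier :> nzRingType;
  fr_basis : 'I_fr_rk.+1 -> fr_carrier;
  fr_N : 'I_fr_rk.+1 -> 'I_fr_rk.+1 -> 'I_fr_rk.+1 -> nat;
  fr_star : fr_carrier -> fr_carrier;
  fr_dual : 'I_fr_rk.+1 -> 'I_fr_rk.+1;
  fr_free : forall c : 'I_fr_rk.+1 -> int,
    \sum_i fr_basis i *~ c i = 0 -> forall i, c i = 0;
  fr_span : forall r : fr_carrier,
    exists c : 'I_fr_rk.+1 -> int, r = \sum_i fr_basis i *~ c i;
  fr_basis0 : fr_basis ord0 = 1;
  fr_basisM : forall i j,
    fr_basis i * fr_basis j = \sum_k fr_basis k *+ fr_N i j k;
  fr_starD : forall a b, fr_star (a + b) = fr_star a + fr_star b;
  fr_starM : forall a b, fr_star (a * b) = fr_star b * fr_star a;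
  fr_starK : involutive fr_star;
  fr_star_basis : forall i, fr_star (fr_basis i) = fr_basis (fr_dual i);
  fr_N0 : forall i j, fr_N i j ord0 = (i == fr_dual j)
}.

Section StructureConstants.
Variable R : fusionRing.
Local Notation I := 'I_(fr_rk R).+1.
Local Notation x := (@fr_basis R).
Local Notation N := (@fr_N R).

Lemma fr_basis_inj (c d : I -> nat) :
  \sum_i x i *+ c i = \sum_i x i *+ d i -> forall i, c i = d i.
Proof.
move=> e i; apply/eqP; rewrite -eqz_nat -subr_eq0; apply/eqP.
apply: (@fr_free R (fun i => (c i)%:Z - (d i)%:Z)).
under eq_bigr do rewrite mulrzBr -!pmulrn.
by rewrite sumrB e subrr.
Qed.

Lemma fr_NA (i j k l : I) :
  (\sum_p N i j p * N p k l = \sum_p N j k p * N i p l)%N.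
Proof.
move: l; apply: fr_basis_inj.
have -> : \sum_l x l *+ (\sum_p N i j p * N p k l)%N = x i * x j * x k.
  rewrite fr_basisM mulr_suml; under eq_bigr do rewrite -sumrMnr.
  rewrite exchange_big; apply: eq_bigr => p _ /=.
  rewrite mulrnAl fr_basisM -sumrMnl; apply: eq_bigr => l _.
  by rewrite -mulrnA mulnC.
rewrite -mulrA fr_basisM mulr_sumr; under [RHS]eq_bigr do rewrite -sumrMnr.
rewrite [RHS]exchange_big; apply: eq_bigr => p _ /=.
rewrite mulrnAr fr_basisM -sumrMnl; apply: eq_bigr => l _.
by rewrite -mulrnA mulnC.
Qed.

Lemma fr_N1l (i k : I) : N ord0 i k = (i == k).
Proof.
move: k; apply: fr_basis_inj; rewrite -fr_basisM fr_basis0 mul1r.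
rewrite (bigD1 i) //= eqxx big1 ?addr0 // => k ki.
by rewrite eq_sym (negPf ki).
Qed.

Lemma fr_N1r (i k : I) : N i ord0 k = (i == k).
Proof.
move: k; apply: fr_basis_inj; rewrite -fr_basisM fr_basis0 mulr1.
rewrite (bigD1 i) //= eqxx big1 ?addr0 // => k ki.
by rewrite eq_sym (negPf ki).
Qed.

End StructureConstants.

(* R (x)_Z F, in coordinates over the standard basis. *)
Definition scalar_ext (F : fieldType) (R : fusionRing) := 'rV[F]_(fr_rk R).+1.

Section ScalarExtension.
Variables (F : fieldType) (R : fusionRing).
Local Notation I := 'I_(fr_rk R).+1.
Local Notation N := (@fr_N R).
Local Notation RF := (scalar_ext F R).

HB.instance Definition _ := Vector.on RF.

Definition ext_basis (i : I) : RF := delta_mx 0 i.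

Definition ext_mul (u v : RF) : RF :=
  \row_k \sum_i \sum_j u 0 i * v 0 j * (N i j k)%:R.

Lemma ext_mulDl : left_distributive ext_mul +%R.
Proof.
move=> u v w; apply/rowP=> k; rewrite !mxE -big_split; apply: eq_bigr => i _ /=.
by rewrite -big_split; apply: eq_bigr => j _ /=; rewrite !mxE !mulrDl.
Qed.

Lemma ext_mulDr : right_distributive ext_mul +%R.
Proof.
move=> u v w; apply/rowP=> k; rewrite !mxE -big_split; apply: eq_bigr => i _ /=.
by rewrite -big_split; apply: eq_bigr => j _ /=; rewrite !mxE mulrDr mulrDl.
Qed.

Lemma ext_scaleAl (a : F) (u v : RF) : a *: ext_mul u v = ext_mul (a *: u) v.
Proof.
apply/rowP=> k; rewrite !mxE mulr_sumr; apply: eq_bigr => i _ /=.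
by rewrite mulr_sumr; apply: eq_bigr => j _; rewrite !mxE !mulrA.
Qed.

Lemma ext_scaleAr (a : F) (u v : RF) : a *: ext_mul u v = ext_mul u (a *: v).
Proof.
apply/rowP=> k; rewrite !mxE mulr_sumr; apply: eq_bigr => i _ /=.
rewrite mulr_sumr; apply: eq_bigr => j _; rewrite !mxE !mulrA.
by rewrite (mulrC a).
Qed.

Lemma ext_mulA : associative ext_mul.
Proof.
move=> u v w; apply/rowP=> l; rewrite !mxE.
transitivity (\sum_i \sum_j \sum_k
  u 0 i * v 0 j * w 0 k * (\sum_p N j k p * N i p l)%N%:R).
  apply: eq_bigr => i _.
  under eq_bigr => p _ do rewrite mxE mulr_sumr mulr_suml.
  rewrite exchange_big; apply: eq_bigr => j _ /=.
  under eq_bigr => p _ do rewrite mulr_sumr mulr_suml.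
  rewrite exchange_big; apply: eq_bigr => k _ /=.
  rewrite natr_sum mulr_sumr; apply: eq_bigr => p _.
  by rewrite natrM !mulrA.
under [RHS]eq_bigr => p _ do
  under eq_bigr => k _ do rewrite mxE mulr_suml mulr_suml.
under [RHS]eq_bigr => p _ do rewrite exchange_big /=.
rewrite [RHS]exchange_big; apply: eq_bigr => i _ /=.
under [RHS]eq_bigr => p _ do
  under eq_bigr => k _ do rewrite mulr_suml mulr_suml.
under [RHS]eq_bigr => p _ do rewrite exchange_big /=.
rewrite [RHS]exchange_big; apply: eq_bigr => j _ /=.
rewrite [RHS]exchange_big; apply: eq_bigr => k _ /=.
rewrite -fr_NA natr_sum mulr_sumr; apply: eq_bigr => p _.
by rewrite natrM !mulrA; congr (_ * _); rewrite mulrAC.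
Qed.

Lemma ext_mul1l : left_id (ext_basis ord0) ext_mul.
Proof.
move=> u; apply/rowP=> k; rewrite mxE (bigD1 ord0) //= [X in _ + X]big1.
  rewrite addr0 (bigD1 k) //= big1 => [|j jk].
    by rewrite mxE !eqxx fr_N1l eqxx mul1r mulr1 addr0.
  by rewrite fr_N1l (negPf jk) mulr0.
by move=> i i0; rewrite big1 // => j _; rewrite mxE eqxx (negPf i0) !mul0r.
Qed.

Lemma ext_mul1r : right_id (ext_basis ord0) ext_mul.
Proof.
move=> u; apply/rowP=> k; rewrite mxE exchange_big (bigD1 ord0) //=.
rewrite [X in _ + X]big1.
  rewrite addr0 (bigD1 k) //= big1 => [|j jk].
    by rewrite mxE !eqxx fr_N1r eqxx !mulr1 addr0.
  by rewrite fr_N1r (negPf jk) mulr0.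
by move=> i i0; rewrite big1 // => j _; rewrite mxE eqxx (negPf i0) mulr0 mul0r.
Qed.

Lemma ext_1neq0 : ext_basis ord0 != 0.
Proof.
by apply/eqP => /rowP/(_ ord0)/eqP; rewrite !mxE !eqxx oner_eq0.
Qed.

HB.instance Definition _ := GRing.Zmodule_isNzRing.Build RF
  ext_mulA ext_mul1l ext_mul1r ext_mulDl ext_mulDr ext_1neq0.
HB.instance Definition _ := GRing.Lmodule_isLalgebra.Build F RF ext_scaleAl.
HB.instance Definition _ := GRing.Lalgebra_isAlgebra.Build F RF ext_scaleAr.
HB.instance Definition _ := Algebra_isFalgebra.Build F RF.

Lemma ext_basis0 : ext_basis ord0 = 1.
Proof. by []. Qed.

Lemma ext_basisM (i j : I) :
  ext_basis i * ext_basis j = \sum_k (N i j k)%:R *: ext_basis k.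
Proof.
apply/rowP=> k; rewrite mxE (bigD1 i) //= [X in _ + X]big1 ?addr0; last first.
  move=> i' ne; rewrite big1 // => j' _.
  by rewrite [in LHS]mxE (negPf ne) andbF !mul0r.
rewrite (bigD1 j) //= [X in _ + X]big1 ?addr0; last first.
  by move=> j' ne; rewrite ![in LHS]mxE (negPf ne) andbF mulr0 mul0r.
rewrite !mxE !eqxx !mul1r summxE (bigD1 k) //= big1 => [|k' ne].
  by rewrite !mxE !eqxx mulr1 addr0.
by rewrite !mxE eq_sym (negPf ne) andbF mulr0.
Qed.

Definition ext_coord (i : I) (u : RF) : F^o := u 0 i.

Lemma ext_coord_linear i : linear (ext_coord i).
Proof. by move=> a u v; rewrite /ext_coord !mxE. Qed.

HB.instance Definition _ i :=
  GRing.isLinear.Build F RF F^o _ (ext_coord i) (ext_coord_linear i).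

Definition dual_basis (i : I) : 'Hom(RF, F^o) := linfun (ext_coord i).

Lemma dual_basisE i j : dual_basis i (ext_basis j) = (i == j)%:R.
Proof. by rewrite lfunE /= /ext_coord mxE eqxx. Qed.

End ScalarExtension.

Definition central (A : nzRingType) (a : A) := forall b : A, a * b = b * a.

Record primitive_central_idempotent (A : nzRingType) (e : A) : Prop := {
  pci_central : central e;
  pci_idem : e * e = e;
  pci_neq0 : e <> 0;
  pci_primitive : forall f : A,
    central f -> f * f = f -> e * f = f -> f = 0 \/ f = e
}.

Section Representations.
Variables (F : fieldType) (A : falgType F).

Record irrep := Irrep {
  irrep_deg : nat;
  irrep_rep :> {lrmorphism A -> 'M[F]_irrep_deg.+1};
  irrep_irr : forall U : {vspace 'cV[F]_irrep_deg.+1},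
    (forall a v, v \in U -> irrep_rep a *m v \in U) -> U = 0%VS \/ U = fullv
}.

Definition corresponds (rho : irrep) (e : A) :=
  primitive_central_idempotent e /\ rho e = 1.

Lemma corresponds_uniq (rho : irrep) (e f : A) :
  corresponds rho e -> corresponds rho f -> e = f.
Proof.
case=> -[ec ei _ ep] re [[fc fi _ fp] rf].
have efc : central (e * f) by move=> b; rewrite -mulrA fc !mulrA ec.
have efi : e * f * (e * f) = e * f.
  by rewrite mulrA -[e * f * e]mulrA (fc e) mulrA ei -mulrA fi.
have ef0 : e * f <> 0.
  move=> /(congr1 rho)/eqP; rewrite rmorphM /= re rf mulr1 raddf0.
  by rewrite oner_eq0.
have [|//|efe] := ep _ efc efi; first by rewrite mulrA ei.
have [|//|eff] := fp _ efc efi; first by rewrite (ec f) mulrA fi.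
by rewrite -efe eff.
Qed.

Lemma irrep_central_idem (rho : irrep) (f : A) :
  central f -> f * f = f -> rho f = 0 \/ rho f = 1.
Proof.
move=> fc fi; pose g : 'End('cV[F]_(irrep_deg rho).+1) := linfun (mulmx (rho f)).
have kerP v : (v \in lker g) = (rho f *m v == 0) by rewrite memv_ker lfunE.
have colP0 (M : 'M[F]_((irrep_deg rho).+1)) : (forall i, col i M = 0) -> M = 0.
  by move=> M0; apply/matrixP=> j i; have /colP/(_ j) := M0 i; rewrite !mxE.
have [|k0|k1] := @irrep_irr rho (lker g).
- move=> a v; rewrite !kerP mulmxA => /eqP fv.
  have -> : rho f *m rho a = rho a *m rho f.
    by have := congr1 rho (fc a); rewrite !rmorphM.
  by rewrite -mulmxA fv mulmx0.
- right; apply/eqP; rewrite -subr_eq0; apply/eqP; apply: colP0 => i.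
  rewrite colE; apply/eqP.
  rewrite -memv0 -k0 kerP mulmxA; apply/eqP.
  have -> : rho f *m (rho f - 1) = 0.
    by rewrite mulmxBr mulmx1 -{3}fi rmorphM subrr.
  by rewrite mul0mx.
left; apply: colP0 => i; rewrite colE.
by apply/eqP; rewrite -kerP k1 memvf.
Qed.

Lemma corresponds_ex (rho : irrep) : exists e, corresponds rho e.
Proof.
pose P (e : A) := [/\ central e, e * e = e & rho e = 1].
pose D (e : A) := \dim (limg (amull e)).
have mem_am (e v : A) : e * v \in limg (amull e).
  have -> : e * v = amull e v by rewrite lfunE.
  exact: memv_img (memvf _).
have min_pci e : P e -> (forall f, P f -> (D e <= D f)%N) -> corresponds rho e.
  case=> ec ei re emin; split=> //; split=> //.
    by move=> e0; move/eqP: re; rewrite e0 raddf0 eq_sym oner_eq0.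
  have key f : P f -> e * f = f -> f = e.
    case=> fc fi rf ef.
    have /eqP efE : limg (amull f) == limg (amull e).
      rewrite eqEdim emin // andbT; apply/subvP => _ /memv_imgP[v _ ->].
      by rewrite lfunE /= -ef -mulrA mem_am.
    have : e \in limg (amull f).
      by rewrite efE -{1}ei mem_am.
    case/memv_imgP=> w _; rewrite lfunE /= => ew.
    by rewrite -ef ec ew mulrA fi.
  move=> f fc fi ef; have [rf|rf] := irrep_central_idem rho fc fi; last first.
    by right; apply: key.
  left; suff h : e - f = e by rewrite -(subKr e f) h subrr.
  apply: key; last by rewrite mulrBr ei ef.
  split; last by rewrite raddfB /= re rf subr0.
    by move=> b; rewrite mulrBl mulrBr ec fc.
  by rewrite mulrBr !mulrBl ei ef fc ef fi subrr subr0.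
have ind n : forall e, P e -> (D e <= n)%N -> exists e, corresponds rho e.
  elim: n => [|n IHn] e Pe De; have [[f [Pf Df]]|Nf] :=
    pselect (exists f, P f /\ (D f < D e)%N).
  - by have := leq_trans Df De.
  - exists e; apply: min_pci => // f Pf; rewrite leqNgt; apply/negP => Df.
    by apply: Nf; exists f.
  - by apply: (IHn f) => //; rewrite -ltnS (leq_trans Df De).
  - exists e; apply: min_pci => // f Pf; rewrite leqNgt; apply/negP => Df.
    by apply: Nf; exists f.
apply: (ind (D 1) 1) => //; split; rewrite ?mulr1 ?rmorph1 //.
by move=> b; rewrite mul1r mulr1.
Qed.

(* The default 0 is never taken: existence and uniqueness are proved above. *)
Definition central_idem (rho : irrep) : A := xget 0 (corresponds rho).

Lemma central_idemP (rho : irrep) : corresponds rho (central_idem rho).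
Proof. by apply: xgetPex; exact: corresponds_ex. Qed.

End Representations.

Section Isaacs.
Variables (K : realType) (R : fusionRing).
Local Open Scope classical_set_scope.
Local Open Scope complex_scope.
Local Notation I := 'I_(fr_rk R).+1.
Local Notation C := K[i].
Local Notation RC := (scalar_ext C R).

(* Acting on row vectors, this is left multiplication by the basis element i. *)
Definition lmul_mx (i : I) : 'M[K]_((fr_rk R).+1) :=
  \matrix_(j, k) (fr_N i j k)%:R.

(* The set is finite and, by the Frobenius-Perron theorem, nonempty, so that
   the supremum is the largest nonnegative eigenvalue. *)
Definition FPdim (i : I) : K :=
  sup [set a : K | 0 <= a /\ eigenvalue (lmul_mx i) a].

Definition FPdimR : K := \sum_(i : I) FPdim i ^+ 2.

Definition fourier (u : RC) : 'Hom(RC, C^o) :=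
  \sum_i u 0 i *: (FPdimR%:C *: dual_basis C (fr_dual i)).

Lemma fourier_basis i :
  fourier (ext_basis C i) = FPdimR%:C *: dual_basis C (fr_dual i).
Proof.
rewrite /fourier (bigD1 i) //= big1 => [|j ji].
  by rewrite mxE !eqxx scale1r addr0.
by rewrite mxE (negPf ji) andbF scale0r.
Qed.

Definition class_sum (rho : irrep RC) : 'Hom(RC, C^o) :=
  fourier (central_idem rho).

Definition omega (i : I) (mu : 'Hom(RC, C^o)) : C :=
  mu (ext_basis C i) / (FPdim i)%:C.

Definition algebraic_integer (z : C) : Prop :=
  integralOver (intr : int -> C) z.

Definition isaacs : Prop :=
  forall (i : I) (rho : irrep RC), algebraic_integer (omega i (class_sum rho)).

End Isaacs.

(* Main.v *)
(** With [tau] the coefficient of [x_0], [omega_i (S^rho)] equals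
    [FPdim(R) / d_i * tau (x_i F^rho)]. For [x_i] central, so is its dual [z],
    and left multiplication by [z] is a normal matrix, hence diagonalizable;
    so [z] acts on each primitive central idempotent [F] as a scalar [c_F],
    an eigenvalue of an integer matrix. Since [tau (x_i z) = 1], summing over
    the decomposition of [1] writes [FPdim(R) / d_i] as the sum of the algebraic
    integers [c_F * omega_i (S^rho)], [F] corresponding to [rho]. *)

Require Import Defs.
From HB Require Import structures.
From mathcomp Require Import all_boot all_order all_algebra all_field.
From mathcomp Require Import boolp.
From mathcomp Require Import complex reals.

Set Implicit Arguments.
Unset Strict Implicit.
Unset Printing Implicit Defensive.

Import GRing.Theory.
Local Open Scope ring_scope.
Local Open Scope complex_scope.

(** * Central idempotents and irreducible representations of a finite-dimensional algebra *)

Section CentralIdempotents.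
Variables (F : fieldType) (A : falgType F).
Implicit Types (a b e f z : A).

(** Induction on the dimension of [e A]: a nonzero non-primitive [e] is [(e - f) + f], both pieces
    generating strictly smaller ideals. *)
Lemma central_idem_ind (P : A -> Prop) :
  P 0 -> (forall e f, P e -> P f -> P (e + f)) ->
  (forall e, primitive_central_idempotent e -> P e) ->
  forall e, central e -> e * e = e -> P e.
Proof.
move=> P0 PD Ppci.
pose D e := \dim (limg (amull e)).
suff ind n e : (D e < n)%N -> central e -> e * e = e -> P e.
  by move=> e; apply: ind (ltnSn _).
elim: n e => [//|n IHn] e; rewrite ltnS => Den ec ei.
have [->//|/eqP e0] := eqVneq e 0.
case: (pselect (primitive_central_idempotent e)) => [/Ppci//|npci].
have [f [fc fi ef f0 fe]] : exists f,
    [/\ central f, f * f = f, e * f = f, f <> 0 & f <> e].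
  apply: contrapT => nex; apply: npci; split=> // f fc fi ef.
  case: (pselect (f = 0)) => [|f0]; first by left.
  case: (pselect (f = e)) => [|fe]; first by right.
  by case: nex; exists f.
(* If the dimensions agreed, then [g A = e A], so [e = g w] and [g = g e = g (g w) = e]. *)
have ltD g : e * g = g -> g * e = g -> g * g = g -> g <> e -> (D g < n)%N.
  move=> eg ge gi ne; apply: leq_trans Den; rewrite ltnNge; apply/negP => le.
  have sub : (limg (amull g) <= limg (amull e))%VS.
    apply/subvP => _ /memv_imgP[v _ ->]; rewrite lfunE /= -eg -mulrA.
    by apply/memv_imgP; exists (g * v); rewrite ?memvf ?lfunE.
  have eqD : limg (amull g) = limg (amull e) by apply/eqP; rewrite eqEdim sub.
  have : e \in limg (amull g).
    by rewrite eqD; apply/memv_imgP; exists e; rewrite ?memvf // lfunE.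
  case/memv_imgP => w _; rewrite lfunE /= => ew.
  by apply: ne; rewrite -ge ew mulrA gi.
have fe' : f * e = f by rewrite fc.
rewrite -(subrK f e); apply: PD; apply: IHn => //; last exact: ltD.
- apply: ltD; rewrite ?mulrBr ?mulrBl ?ei ?ef ?fe' ?fi ?subrr ?subr0 //.
  by move=> h; apply: f0; rewrite -(subKr e f) h subrr.
- by move=> b; rewrite mulrBl mulrBr ec fc.
- by rewrite mulrBr !mulrBl ei ef fe' fi subrr subr0.
Qed.

Lemma central_horner_alg z p : central z -> central (horner_alg z p).
Proof.
move=> zc b; elim/poly_ind: p => [|p c IHp]; first by rewrite rmorph0 mul0r mulr0.
rewrite rmorphD rmorphM /= horner_algX horner_algC mulrDl mulrDr.
by rewrite mulr_algl mulr_algr -mulrA zc !mulrA IHp.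
Qed.

(* A Bezout relation between ['X - r] and the other factors splits [e] into
   two central idempotents, one of which vanishes by primitivity. *)
Lemma pci_eigenvalue z e (rs : seq F) :
  primitive_central_idempotent e -> central z -> uniq rs ->
  horner_alg z (\prod_(r <- rs) ('X - r%:P)) = 0 ->
  exists r, z * e = r *: e.
Proof.
move=> [ec ei e0 ep] zc urs pz0.
(* Annihilation is only kept on [e]: this weaker form survives dropping a root in the induction. *)
have {pz0} : horner_alg z (\prod_(r <- rs) ('X - r%:P)) * e = 0.
  by rewrite pz0 mul0r.
elim: rs urs => [_|r rs IHrs /= /andP[rNrs urs]].
  by rewrite big_nil rmorph1 mul1r => /e0.
rewrite big_cons => pz0.
set q := \prod_(s <- rs) _ in pz0.
have cop : coprimep ('X - r%:P) q.
  by rewrite coprimep_sym coprimep_XsubC root_prod_XsubC.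
have [[u v] /= uv] := Bezout_eq1_coprimepP _ _ cop.
pose h := horner_alg z.
have hC p : central (h p) by exact: central_horner_alg.
set a := u * ('X - r%:P) in uv; set b := v * q in uv.
have ab1 : h a + h b = 1 by rewrite -rmorphD uv rmorph1.
have abe : h a * h b * e = 0.
  rewrite -rmorphM /= /a /b mulrACA.
  by rewrite rmorphM /= -mulrA pz0 mulr0.
have fc : central (h a * e) by move=> c; rewrite -mulrA ec !mulrA hC.
have fi : h a * e * (h a * e) = h a * e.
  rewrite -mulrA (mulrA e) ec -mulrA ei mulrA.
  by rewrite -[X in _ = X]subr0 -abe -mulrBl -[X in X - _]mulr1 -mulrBr -ab1 addrK.
have ef : e * (h a * e) = h a * e by rewrite mulrA -hC -mulrA ei.
have [ae|ae] := ep _ fc fi ef.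
  (* Here [e = h b * e], and [('X - r) * b] is a multiple of the annihilating product. *)
  exists r; apply/eqP; rewrite -subr_eq0 -mulr_algl -mulrBl.
  have -> : z - r%:A = h ('X - r%:P).
    by rewrite /h rmorphB /= horner_algX horner_algC.
  rewrite -[e]mul1r -ab1 mulrDl ae add0r /b mulrA -!rmorphM /= mulrCA.
  by rewrite rmorphM /= -mulrA pz0 mulr0.
(* Here [h a * e = e], and [q * a] is a multiple of that product, so [q] alone kills [e]. *)
apply: IHrs => //; rewrite -/h -ae.
rewrite mulrA -rmorphM /= /a [q * _]mulrC -mulrA.
by rewrite rmorphM /= -mulrA pz0 mulr0.
Qed.

(* The representation is the action on a minimal nonzero left ideal inside
   the ideal generated by [e]. *)
Lemma pci_irrep e :
  primitive_central_idempotent e -> exists rho : irrep A, corresponds rho e.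
Proof.
move=> epci; have [ec ei e0 _] := epci.
pose L (U : {vspace A}) := [/\ U <> 0%VS, forall a v, v \in U -> a * v \in U &
  forall v, v \in U -> e * v = v].
(* The dimensions of nonzero left ideals on which [e] acts as the identity; [e A] supplies one, so
   there is a least. *)
pose Q n := `[< exists U, L U /\ \dim U = n >].
have Qex : exists n, Q n.
  exists (\dim (limg (amull e))); apply/asboolP; exists (limg (amull e)).
  split=> //; split=> [E|a _ /memv_imgP[v _ ->]|_ /memv_imgP[v _ ->]].
  - apply/e0/eqP; rewrite -memv0 -E; apply/memv_imgP.
    by exists e; rewrite ?memvf // lfunE.
  - by apply/memv_imgP; exists (a * v); rewrite ?memvf // !lfunE /= !mulrA ec.
  - by rewrite lfunE /= mulrA ei.
case: (ex_minnP Qex) => d /asboolP[U [[U0 Ul Ue] dU]] dmin.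
(* The length is a successor because [irrep] represents by matrices of size [irrep_deg.+1]. *)
have [n [b bU]] : exists n, exists b : n.+1.-tuple A, basis_of U b.
  have [n dUn] : exists n, \dim U = n.+1.
    by exists (\dim U).-1; rewrite prednK // lt0n dimv_eq0; apply/eqP.
  have sz : size (vbasis U) == n.+1 by rewrite size_tuple dUn.
  by exists n, (Tuple sz); apply: vbasisP.
have {}dU : d = n.+1 by rewrite -dU (size_basis bU).
have bin j : b`_j \in U.
  have [jn|nj] := ltnP j n.+1; last by rewrite nth_default ?size_tuple ?mem0v.
  by apply: (basis_mem bU); rewrite mem_nth ?size_tuple.
pose phi (v : 'cV[F]_n.+1) : A := \sum_k v k 0 *: b`_k.
have phi_lin : linear phi.
  move=> c v w; rewrite /phi scaler_sumr -big_split; apply: eq_bigr => k _ /=.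
  by rewrite !mxE scalerDl scalerA.
pose r (a : A) : 'M[F]_n.+1 := \matrix_(j, k) coord b j (a * b`_k).
have rE a v : phi (r a *m v) = a * phi v.
  rewrite /phi mulr_sumr.
  under eq_bigr => j _ do rewrite mxE scaler_suml.
  rewrite exchange_big; apply: eq_bigr => k _ /=.
  rewrite -scalerAr [in RHS](coord_basis bU (Ul a _ (bin k))) scaler_sumr.
  by apply: eq_bigr => j _; rewrite mxE scalerA mulrC.
have coord_phi v k : coord b k (phi v) = v k 0.
  by rewrite /phi coord_sum_free // (basis_free bU).
have phi_inj : injective phi.
  by move=> v w E; apply/colP => k; rewrite -!coord_phi E.
have matP (M N : 'M[F]_n.+1) : (forall v : 'cV_n.+1, M *m v = N *m v) -> M = N.
  move=> E; apply/matrixP => j k.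
  by have /colP/(_ j) := E (delta_mx k 0); rewrite -!colE !mxE.
have r_lin : linear r.
  by move=> c x y; apply/matrixP => j k; rewrite !mxE mulrDl -scalerAl linearP.
have r_mul : monoid_morphism r.
  split; first by apply: matP => v; apply: phi_inj; rewrite rE mul1r mul1mx.
  by move=> x y; apply: matP => v; apply: phi_inj; rewrite -mulmxA !rE mulrA.
pose rL := GRing.isLinear.Build F A 'M[F]_n.+1 _ r r_lin.
pose rM := GRing.isMonoidMorphism.Build A 'M[F]_n.+1 r r_mul.
pose rho : {lrmorphism A -> 'M[F]_n.+1} := HB.pack r rL rM.
pose pL := GRing.isLinear.Build F 'cV[F]_n.+1 A _ phi phi_lin.
pose ph : {linear 'cV[F]_n.+1 -> A} := HB.pack phi pL.
have irr (W : {vspace 'cV[F]_n.+1}) :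
    (forall a v, v \in W -> rho a *m v \in W) -> W = 0%VS \/ W = fullv.
  (* A stable [W] is carried by [phi] to a left ideal inside [U]; if nonzero, it has full dimension
     by minimality. *)
  move=> Wst; pose V := (linfun ph @: W)%VS.
  have VP v : v \in V -> exists2 w, w \in W & v = phi w.
    by case/memv_imgP => w Ww ->; exists w; rewrite ?lfunE.
  have PV w : w \in W -> phi w \in V.
    by move=> Ww; apply/memv_imgP; exists w; rewrite ?lfunE.
  have [V0|/eqP V0] := eqVneq V 0%VS.
    left; apply/eqP; rewrite -subv0; apply/subvP => w /PV.
    rewrite V0 !memv0 => /eqP E; apply/eqP/phi_inj.
    by rewrite E; apply/esym/(linear0 ph).
  right; apply/eqP; rewrite eqEdim subvf /=.
  have le1 : (n.+1 <= \dim V)%N.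
    rewrite -dU; apply: dmin; apply/asboolP; exists V; split=> //; split=> //.
      by move=> a _ /VP[w Ww ->]; rewrite -rE; apply: PV; apply: Wst.
    move=> _ /VP[w Ww ->]; apply: Ue; rewrite /phi.
    by apply: rpred_sum => k _; apply: rpredZ.
  rewrite dimvf /dim /= muln1; apply: leq_trans le1 _.
  by rewrite -(limg_ker_dim (linfun ph) W) leq_addl.
exists (Irrep irr); split=> //=; apply: matP => v; apply: phi_inj.
rewrite rE mul1mx; apply: Ue; rewrite /phi.
by apply: rpred_sum => k _; apply: rpredZ.
Qed.

End CentralIdempotents.

(** * Duality and symmetries of the structure constants *)

Section FusionRing.
Variable R : fusionRing.
Local Notation I := 'I_(fr_rk R).+1.
Local Notation x := (@fr_basis R).
Local Notation N := (@fr_N R).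
Local Notation dual := (@fr_dual R).
Implicit Types i j k l : I.

Lemma fr_basis_injective : injective x.
Proof.
move=> i j E; have sumE l : \sum_k x k *+ (l == k) = x l.
  rewrite (bigD1 l) //= eqxx big1 ?addr0 // => k kl.
  by rewrite eq_sym (negPf kl).
have := @fr_basis_inj R (fun k => i == k) (fun k => j == k).
rewrite !sumE => /(_ E i); rewrite eqxx.
by case: eqVneq.
Qed.

Lemma fr_dualK : involutive dual.
Proof.
by move=> i; apply: fr_basis_injective; rewrite -!fr_star_basis fr_starK.
Qed.

Lemma fr_N_star i j k : N i j k = N (dual j) (dual i) (dual k).
Proof.
move: k; apply: fr_basis_inj.
rewrite -fr_basisM -[x i]fr_starK -[x j]fr_starK -fr_starM !fr_star_basis.
rewrite fr_basisM (reindex_inj (can_inj fr_dualK)) /=.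
elim/big_ind2: _ => [|a b c d|k _].
(* [fr_star 0 = 0] follows by cancellation in [fr_star (0 + 0)]. *)
- by apply: (addrI (fr_star 0)); rewrite -fr_starD !addr0.
- by move=> <- <-; rewrite fr_starD.
elim: (N _ _ _) => [|m IHm].
  by apply: (addrI (fr_star 0)); rewrite -fr_starD !addr0.
by rewrite !mulrSr fr_starD IHm fr_star_basis fr_dualK.
Qed.

(** Compare the coefficients of [x_0] in the two bracketings of [x_i x_j x_{k*}]. *)
Lemma fr_N_cyclic i j k : N i j k = N j (dual k) (dual i).
Proof.
have := fr_NA i j (dual k) ord0.
rewrite (bigD1 k) //= big1 ?addn0 => [|p pk]; last first.
  by rewrite fr_N0 fr_dualK (negPf pk) muln0.
rewrite (bigD1 (dual i)) //= big1 ?addn0 => [|p pk]; last first.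
  by rewrite fr_N0 eq_sym (can2_eq fr_dualK fr_dualK) (negPf pk) muln0.
by rewrite !fr_N0 !fr_dualK !eqxx !muln1.
Qed.

(** In matrix terms, [x_{i*}] acts on the left by the transpose of [x_i]. *)
Lemma fr_N_duall i j k : N (dual i) j k = N i k j.
Proof.
by rewrite [LHS]fr_N_cyclic fr_dualK [RHS]fr_N_cyclic [RHS]fr_N_star !fr_dualK.
Qed.

Lemma central_fr_NC i : central (x i) -> forall j k, N i j k = N j i k.
Proof. by move=> ic j; apply: fr_basis_inj; rewrite -!fr_basisM. Qed.

Lemma central_fr_dual i : central (x i) -> central (x (dual i)).
Proof.
move=> ic b; rewrite -fr_star_basis -[b]fr_starK -!fr_starM.
by rewrite ic.
Qed.

End FusionRing.

(** * Left multiplication by basis elements as matrices *)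

Section ScalarExtension.
Variables (F : fieldType) (R : fusionRing).
Local Notation I := 'I_(fr_rk R).+1.
Local Notation N := (@fr_N R).
Local Notation RF := (scalar_ext F R).

Lemma ext_basis_mulE i (u : RF) k :
  (ext_basis F i * u) 0 k = \sum_j u 0 j * (N i j k)%:R.
Proof.
rewrite [LHS]mxE (bigD1 i) //= [X in _ + X]big1 ?addr0 => [|j ji].
  by apply: eq_bigr => j _; rewrite mxE !eqxx mul1r.
by rewrite big1 // => l _; rewrite mxE (negPf ji) andbF !mul0r.
Qed.

Lemma ext_mul_basisE i (u : RF) k :
  (u * ext_basis F i) 0 k = \sum_j u 0 j * (N j i k)%:R.
Proof.
rewrite [LHS]mxE; apply: eq_bigr => j _.
rewrite (bigD1 i) //= [X in _ + X]big1 ?addr0 => [|l li].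
  by rewrite [ext_basis F i 0 i]mxE !eqxx mulr1.
by rewrite [ext_basis F i 0 l]mxE (negPf li) andbF mulr0 mul0r.
Qed.

Lemma central_ext_basis i : central (fr_basis i) -> central (ext_basis F i : RF).
Proof.
move=> ic u; apply/rowP => k; rewrite ext_basis_mulE ext_mul_basisE.
by apply: eq_bigr => j _; rewrite (central_fr_NC ic).
Qed.

(** The matrix [lmul_mx], over an arbitrary field so that complex scalars are allowed. *)
Definition lmul_ext_mx (i : I) : 'M[F]_((fr_rk R).+1) :=
  \matrix_(j, k) (N i j k)%:R.

Lemma mul_lmul_ext_mx i (u : RF) : u *m lmul_ext_mx i = ext_basis F i * u.
Proof.
apply/rowP => k; rewrite ext_basis_mulE mxE.
by apply: eq_bigr => j _; rewrite mxE.
Qed.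

Lemma mul_horner_lmul_ext_mx i p (u : RF) :
  u *m horner_mx (lmul_ext_mx i) p = horner_alg (ext_basis F i : RF) p * u.
Proof.
elim/poly_ind: p u => [|p c IHp] u; first by rewrite !rmorph0 mulmx0 mul0r.
rewrite [p * 'X in LHS]mulrC !rmorphD !rmorphM /= horner_mx_X horner_mx_C horner_algX horner_algC.
rewrite mulmxDr mulmxA IHp mul_lmul_ext_mx mul_mx_scalar mulrDl mulr_algl.
by rewrite mulrA.
Qed.

(** The row [e] is an eigenvector of an integer matrix, whose characteristic polynomial is monic. *)
Lemma eigenvalue_ext_basis_integral i (e : RF) c :
  e <> 0 -> ext_basis F i * e = c *: e -> integralOver (intr : int -> F) c.
Proof.
move=> e0 ec; pose Z : 'M[int]_((fr_rk R).+1) := \matrix_(j, k) (N i j k)%:Z.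
exists (char_poly Z); first exact: char_poly_monic.
rewrite map_char_poly -eigenvalue_root_char.
have -> : map_mx intr Z = lmul_ext_mx i.
  by apply/matrixP => j k; rewrite !mxE -pmulrn.
by apply/eigenvalueP; exists e; [rewrite mul_lmul_ext_mx | apply/eqP].
Qed.

End ScalarExtension.

(** * Normality and integral eigenvalues *)

Section ComplexScalars.
Variables (C : numClosedFieldType) (R : fusionRing).
Local Notation RC := (scalar_ext C R).

Lemma lmul_ext_mx_normal i :
  central (fr_basis i) -> lmul_ext_mx C (R := R) i \is normalmx.
Proof.
move=> ic; apply/normalmxP.
have -> : ((lmul_ext_mx C i) ^t* )%sesqui = lmul_ext_mx C (fr_dual i).
  by apply/matrixP => j k; rewrite !mxE rmorph_nat fr_N_duall.
apply/matrixP => j l; rewrite !mxE.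
under eq_bigr => p _ do rewrite !mxE -natrM.
under [RHS]eq_bigr => p _ do rewrite !mxE -natrM.
rewrite -!natr_sum; congr (_%:R).
(* Centrality of [x_i] turns the goal into associativity of [x_{i*} x_j x_i]. *)
under eq_bigr => p _ do rewrite (central_fr_NC ic) mulnC.
under [RHS]eq_bigr => p _ do rewrite (central_fr_NC ic).
rewrite [RHS]fr_NA; apply: eq_bigr => p _.
by rewrite mulnC.
Qed.

Lemma pci_ext_basis_eigen i (e : RC) :
  central (fr_basis i) -> primitive_central_idempotent e ->
  exists2 c, ext_basis C i * e = c *: e & integralOver (intr : int -> C) c.
Proof.
move=> ic epci; pose M := lmul_ext_mx C (R := R) i.
have Mdiag : diagonalizable M.
  exists (spectralmx M); first exact: spectral_unit.
  apply/(diagonalizable_forLR (spectral_unit _)).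
  exists (spectral_diag M); rewrite mxpoly.conjVmx ?spectral_unit //.
  exact/orthomx_spectralP/lmul_ext_mx_normal.
(* Diagonalizability yields an annihilating polynomial with distinct roots; applied to the row [1],
   it annihilates the basis element itself. *)
have [rs urs /mxminpoly_minP hrs] := (diagonalizableP _).1 Mdiag.
have [|c ce] := pci_eigenvalue epci (central_ext_basis ic) urs.
  by rewrite -[LHS]mulr1 -mul_horner_lmul_ext_mx hrs mulmx0.
exists c => //; apply: eigenvalue_ext_basis_integral ce.
by case: epci.
Qed.

End ComplexScalars.

Theorem theorem4p3 (K : realType) (R : fusionRing) (i : 'I_(fr_rk R).+1) :
  isaacs K R ->
  central (fr_basis i) ->
  algebraic_integer ((FPdimR K R / FPdim K i)%:C).
Proof.
move=> isa ic; set D := _%:C.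
pose RC := scalar_ext K[i] R.
pose z : RC := ext_basis _ (fr_dual i).
(* This is additive in [f], and [P 1] is the goal because [x_i x_{i*}] has [x_0]-coefficient 1. *)
pose P (f : RC) := algebraic_integer (D * (ext_basis _ i * (z * f) : RC) 0 0).
have omegaE (rho : irrep RC) :
    omega i (class_sum rho) = D * (ext_basis _ i * central_idem rho : RC) 0 0.
  rewrite /omega /class_sum /fourier sum_lfunE ext_basis_mulE /D rmorphM /= fmorphV.
  (* Both sides sum over [j]; [N i j 0] and the dual basis vector of [j*] at [x_i] both test
     [i = j*]. *)
  rewrite mulrAC; congr (_ / _); rewrite mulr_sumr; apply: eq_bigr => j _.
  rewrite !lfunE /= !lfunE /= dual_basisE fr_N0 eq_sym.
  by rewrite /GRing.scale /= mulrCA.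
suff : P 1.
  rewrite /P mulr1 ext_basis_mulE (bigD1 (fr_dual i)) //= big1 ?addr0.
    by rewrite mxE !eqxx fr_N0 fr_dualK eqxx !mulr1.
  by move=> j ji; rewrite mxE (negPf ji) andbF mul0r.
apply: central_idem_ind => [|e f Pe Pf|e epci|b|]; last 2 first.
- by rewrite mul1r mulr1.
- by rewrite mulr1.
- by rewrite /P !mulr0 mxE mulr0; apply: integral0.
- by rewrite /P !mulrDr mxE mulrDr; apply: integral_add.
have [c ce cint] := pci_ext_basis_eigen (central_fr_dual ic) epci.
have [rho rhoe] := pci_irrep epci.
(* The scalar [c] comes out, leaving [c] times a value that the Isaacs property makes integral. *)
rewrite /P /z ce -scalerAr mxE mulrCA; apply: integral_mul => //.
rewrite (corresponds_uniq rhoe (central_idemP rho)) -omegaE.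
exact: isa.
Qed.
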